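(* With the addition $+$ and multiplication $\times$ defined digit-wise on infinite decimals as in the context, $(\mathbb{R},+,\times)$ is a field, where $\mathbb{R}$ denotes the set of infinite decimals $\{a_0.a_1a_2a_3\cdots\in\mathbb{Z}\times\mathbb{Z}_{10}^{\mathbb{N}}: a_k<9\text{ for infinitely many }k\}$.
   Context: Here $\mathbb{Z}_{10}=\{0,1,\ldots,9\}$ is the set of digits, $\mathbb{N}=\{1,2,3,\ldots\}$, and $\mathbb{R}$ denotes the concrete set of infinite decimals $a_0.a_1a_2a_3\cdots$ with $a_0\in\mathbb{Z}$, $a_k\in\mathbb{Z}_{10}$ for $k\ge1$, and $a_k<9$ for infinitely many $k$ (not a previously constructed real number system). Terminating decimals. An element $x=a_0.a_1a_2\cdots$ is terminating if there is an integer $m\ge0$ with $a_k=0$ for all $k>m$; it is then written $a_0.a_1\cdots a_m$ and identified with the rational number $a_0+\sum_{i=1}^m a_i10^{-i}$ (so for negative $a_0$ the fractional part is still added, e.g. $(-3).4=-2.6$). Sums, products, negatives and comparisons of terminating decimals are the usual ones for rational numbers; $10^{-m}$ is regarded as a terminating decimal. Digits and truncations. For $x=a_0.a_1a_2\cdots$ and an integer $k\ge0$, $\theta_k(x)=a_k$ is the $k$-th digit of $x$, and $x_k=a_0.a_1\cdots a_k$ is the truncation of $x$ up to the $k$-th digit, a terminating decimal. This notation is also applied to terminating decimals obtained as sums or products: $(u)_k$ is the truncation of $u$. Order and sign. Elements are compared lexicographically. An element is non-negative if $a_0\ge0$ and negative if $a_0<0$. Addition. Let $x=a_0.a_1a_2\cdots$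 and $y=b_0.b_1b_2\cdots$ be in $\mathbb{R}$. Case 1: if there is an integer $m\ge0$ with $a_k+b_k=9$ for all $k>m$, then $x+y=x_m+y_m+10^{-m}$. Case 2: otherwise there are positive integers $k_1<k_2<\cdots$ with $a_{k_i}+b_{k_i}\ne9$ for all $i\in\mathbb{N}$, and $x+y$ is the infinite decimal determined by $(x+y)_{k_i-1}=(x_{k_i}+y_{k_i})_{k_i-1}$ for all $i\in\mathbb{N}$. Additive inverse. Let $x=a_0.a_1a_2\cdots\in\mathbb{R}$. If there is an integer $m\ge0$ with $a_k=0$ for all $k>m$, then $-x=-x_m$ (negative of a terminating decimal). Otherwise $-x=(-1-a_0).(9-a_1)(9-a_2)(9-a_3)\cdots$. Multiplication. Let $x,y\in\mathbb{R}$. (1) If $x,y$ are both non-negative, fix an integer $s\ge0$ with $x+y\le10^s$. Case 1: if there is an integer $m\ge0$ with $\theta_k(x_{k+s}y_{k+s})=9$ for all $k>m$, then $xy=(x_{m+s}y_{m+s})_m+10^{-m}$. Case 2: otherwise there are positive integers $k_1<k_2<\cdots$ with $\theta_{k_i}(x_{k_i+s}y_{k_i+s})\ne9$ for all $i\in\mathbb{N}$, and $xy$ is the infinite decimal determined by $(xy)_{k_i-1}=(x_{k_i+s}y_{k_i+s})_{k_i-1}$ for all $i\in\mathbb{N}$. (2) If $x,y$ are both negative, $xy=(-x)(-y)$. (3) If exactly one of $x,y$ is negative, $xy=-(x(-y))$ when $y$ is the negative one, and symmetrically $xy=-((-x)y)$ when $x$ is the negative one. The product is also written $x\times y$. These prescriptions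 do not depend on the choices of $m$, $s$ or $(k_i)$ and yield elements of $\mathbb{R}$. *)

(* Defs.v *)
From HB Require Import structures.
From mathcomp Require Import all_boot all_order all_algebra.
From mathcomp Require Import boolp classical_sets.

Set Implicit Arguments.
Unset Strict Implicit.
Unset Printing Implicit Defensive.

Import Order.TTheory GRing.Theory Num.Theory.
Local Open Scope ring_scope.

(* An infinite decimal a_0.a_1a_2a_3...  The digit a_k, for k >= 1, is stored
   as [frac_digit k.-1], so that [frac_digit] carries no junk value. *)
Record decimal := Decimal {
  int_part : int;
  frac_digit : nat -> 'I_10;
  frac_digit_lt9 : forall m : nat, exists2 k : nat, (m <= k)%N & (frac_digit k < 9)%N
}.

Definition zero_decimal : decimal :=
  @Decimal 0 (fun=> ord0) (fun m => ex_intro2 _ _ m (leqnn m) isT).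

HB.instance Definition _ := gen_eqMixin decimal.
HB.instance Definition _ := gen_choiceMixin decimal.
(* The base point is only the default value of the choice operator [get]. *)
HB.instance Definition _ := isPointed.Build decimal zero_decimal.

Definition theta (x : decimal) (k : nat) : int :=
  if k is j.+1 then (frac_digit x j : nat)%:Z else int_part x.

(* Terminating decimals are identified with rational numbers: [trunc x k] is
   the rational a_0 + sum_{i=1}^k a_i 10^{-i}, and [of_rat] goes back, from a
   rational which is the value of a terminating decimal to that decimal. *)
Definition trunc (x : decimal) (k : nat) : rat :=
  (theta x 0)%:~R + \sum_(1 <= i < k.+1) (theta x i)%:~R * 10 ^- i.

Definition terminates_at (x : decimal) (m : nat) : Prop :=
  forall k : nat, (m < k)%N -> theta x k = 0.

Definition of_rat (q : rat) : decimal :=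
  get [set x : decimal | exists2 m, terminates_at x m & trunc x m = q]%classic.

Definition lt_decimal (x y : decimal) : Prop :=
  exists2 k : nat,
    (forall i : nat, (i < k)%N -> theta x i = theta y i) & theta x k < theta y k.

Definition le_decimal (x y : decimal) : Prop := x = y \/ lt_decimal x y.

(* A sequence of positive integers k_1 < k_2 < ..., with k_{i+1} = [k i]. *)
Definition increasing_pos (k : nat -> nat) : Prop :=
  (0 < k 0)%N /\ forall i : nat, (k i < k i.+1)%N.

(* The two cases in the definition of x + y; [add_spec x y z] means that z is
   a value of x + y for some choice of m, resp. of (k_i). *)
Definition add_case1 (x y : decimal) (m : nat) : Prop :=
  forall k : nat, (m < k)%N -> theta x k + theta y k = 9.

Definition add_spec (x y z : decimal) : Prop :=
  (exists2 m, add_case1 x y m & z = of_rat (trunc x m + trunc y m + 10 ^- m))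
  \/ (~ (exists m, add_case1 x y m)) /\
     (exists k : nat -> nat,
        [/\ increasing_pos k,
            forall i, theta x (k i) + theta y (k i) <> 9 &
            forall i, trunc z (k i).-1
                      = trunc (of_rat (trunc x (k i) + trunc y (k i))) (k i).-1]).

Definition add_decimal (x y : decimal) : decimal := get (add_spec x y).

Definition opp_spec (x z : decimal) : Prop :=
  (exists2 m, terminates_at x m & z = of_rat (- trunc x m))
  \/ [/\ ~ (exists m, terminates_at x m),
         theta z 0 = - 1 - theta x 0 &
         forall k : nat, (0 < k)%N -> theta z k = 9 - theta x k].

Definition opp_decimal (x : decimal) : decimal := get (opp_spec x).

(* Product of non-negative decimals: [trunc_prod s x y k] is the terminating
   decimal x_{k+s} y_{k+s}, where x + y <= 10^s. *)
Definition trunc_prod (s : nat) (x y : decimal) (k : nat) : decimal :=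
  of_rat (trunc x (k + s)%N * trunc y (k + s)%N).

Definition mul_case1 (s : nat) (x y : decimal) (m : nat) : Prop :=
  forall k : nat, (m < k)%N -> theta (trunc_prod s x y k) k = 9.

Definition mul_nonneg_spec (x y z : decimal) : Prop :=
  exists2 s : nat, le_decimal (add_decimal x y) (of_rat (10 ^+ s)) &
  (exists2 m, mul_case1 s x y m &
     z = of_rat (trunc (trunc_prod s x y m) m + 10 ^- m))
  \/ (~ (exists m, mul_case1 s x y m)) /\
     (exists k : nat -> nat,
        [/\ increasing_pos k,
            forall i, theta (trunc_prod s x y (k i)) (k i) <> 9 &
            forall i, trunc z (k i).-1
                      = trunc (trunc_prod s x y (k i)) (k i).-1]).

Definition mul_nonneg (x y : decimal) : decimal := get (mul_nonneg_spec x y).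

Definition nonneg (x : decimal) : bool := 0 <= theta x 0.

Definition mul_decimal (x y : decimal) : decimal :=
  match nonneg x, nonneg y with
  | true, true => mul_nonneg x y
  | false, false => mul_nonneg (opp_decimal x) (opp_decimal y)
  | true, false => opp_decimal (mul_nonneg x (opp_decimal y))
  | false, true => opp_decimal (mul_nonneg (opp_decimal x) y)
  end.

(* (T, add, mul) is a field: T carries a [fieldType] structure whose addition
   and multiplication are the given operations. *)
Definition is_field (T : Type) (add mul : T -> T -> T) : Prop :=
  exists c : GRing.Field T,
    let K := GRing.Field.Pack c in
    @GRing.add K = add /\ @GRing.mul K = mul.

(* Main.v *)
(* Each decimal x is attached to the real number [value x], the supremum of its
   truncations, so that [floor (10 ^ k * value x)] is the integer a_0a_1...a_k;
   this is a bijection onto the reals.  The digit-wise operations are the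
   preimages of the real ones under it, hence the field axioms.  For the sum and
   the product of x and y, the approximants p_k computed from truncated operands
   satisfy p_k <= r <= p_k + C 10^-k with C <= 2, r being the exact result.  If
   the k-th digit is not 9 no carry can reach position k - 1, so p_k and r agree
   up to that position; if it is always 9 beyond m, then r is the truncation of
   p_m plus 10^-m.  For the product this last point needs the sharper estimate
   p_k <= p_(k+1) <= p_k + 9 * 10^-(k+1). *)

From HB Require Import structures.
From mathcomp Require Import all_boot all_order all_algebra.
From mathcomp Require Import boolp classical_sets reals Rstruct.
From mathcomp Require Import zify ring lra.
Require Import Defs.

Set Implicit Arguments.
Unset Strict Implicit.
Unset Printing Implicit Defensive.

Import Order.TTheory GRing.Theory Num.Theory.
Local Open Scope ring_scope.

Lemma exp10_gt0 (F : numFieldType) k : 0 < 10 ^+ k :> F.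
Proof. by rewrite exprn_gt0. Qed.

Lemma exp10_neq0 (F : numFieldType) k : 10 ^+ k != 0 :> F.
Proof. by rewrite lt0r_neq0 ?exp10_gt0. Qed.

(** * Real numbers scaled by powers of ten *)

Section Scaling.
Variable R : archiRealFieldType.
Implicit Types (r : R) (a : nat -> int).

Lemma ltr_exp10 r : exists k, r < 10 ^+ k.
Proof.
exists (Num.truncn r).+1; have /(lt_le_trans (truncnS_gt r)) :
  (Num.truncn r).+1%:R <= 10 ^+ (Num.truncn r).+1 :> R; last exact.
by rewrite -natrX ler_nat ltnW // ltn_expl.
Qed.

(** For [r] nonzero, 10^k |r| exceeds [C] from some [k] on. Equalities of reals are proved below by
    applying this to a difference. *)
Lemma scaled_bounded_eq0 r (C : R) :
    (forall m, exists2 k, (m <= k)%N & `|10 ^+ k * r| <= C) -> r = 0.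
Proof.
move=> rC; apply/eqP; apply: contraT => r_neq0.
have [m Cm] := ltr_exp10 (C / `|r|).
have [k le_mk] := rC m; rewrite leNgt normrM ger0_norm ?ltW ?exp10_gt0 //.
rewrite -ltr_pdivrMr ?normr_gt0 // (lt_le_trans Cm) //.
by rewrite ler_weXn2l // ler1n.
Qed.

(* A block of digits [9] beyond position [m] amounts to a carry into it. *)
Lemma carry_nines a r (C : R) m :
    (forall k, (m <= k)%N -> a k.+1 = 10 * a k + 9) ->
    (forall k, (m <= k)%N -> (a k)%:~R <= 10 ^+ k * r <= (a k)%:~R + C) ->
  10 ^+ m * r = (a m + 1)%:~R.
Proof.
move=> a_rec a_r; apply/eqP; rewrite -subr_eq0; apply/eqP.
(* The recursion multiplies [a k + 1] by ten, so 10^j (10^m r - (a m + 1)) stays between -1 and C -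
   1. *)
have aE j : a (j + m)%N + 1 = 10 ^+ j * (a m + 1).
  elim: j => [|j IHj]; first by rewrite mul1r.
  by rewrite addSn a_rec ?leq_addl // exprS -mulrA -IHj; ring.
apply: (@scaled_bounded_eq0 _ (`|C| + 1)) => j; exists j => //.
have := a_r (j + m)%N (leq_addl _ _).
have -> : (a (j + m)%N)%:~R = 10 ^+ j * (a m + 1)%:~R - 1 :> R.
  by apply/eqP; rewrite eq_sym subr_eq -(intrD _ _ 1) aE intrM rmorphXn.
rewrite exprD -mulrA mulrBr => /andP[lo hi]; rewrite ler_norml.
have := ler_norm C; lra.
Qed.

(** Equal floors keep the scaled difference within 1. Infinitely many positions suffice, which suits
    the sequences (k_i) of the specifications. *)
Lemma floor_exp10_inj r r' :
    (forall m, exists2 k, (m <= k)%N &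
       Num.floor (10 ^+ k * r) = Num.floor (10 ^+ k * r')) -> r = r'.
Proof.
move=> rr'; apply/eqP; rewrite -subr_eq0; apply/eqP.
apply: (@scaled_bounded_eq0 _ 1) => m; have [k le_mk eqk] := rr' m.
exists k => //; have := floor_itv (10 ^+ k * r); rewrite eqk.
have := floor_itv (10 ^+ k * r'); rewrite mulrBr intrD ler_norml.
by move=> /andP[? ?] /andP[? ?]; apply/andP; split; lra.
Qed.

Lemma floor_exp10S r k :
  0 <= Num.floor (10 ^+ k.+1 * r) - 10 * Num.floor (10 ^+ k * r) < 10.
Proof.
rewrite subr_ge0 ltrBlDr floor_ge_int floor_lt_int exprS -mulrA.
have := floor_itv (10 ^+ k * r); rewrite !intrD !intrM.
by move=> /andP[? ?]; apply/andP; split; lra.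
Qed.

End Scaling.

(** * Decimals read as integers, digit by digit *)

Definition scaled_trunc (x : decimal) (k : nat) : int :=
  iteri k (fun i n => 10 * n + theta x i.+1) (theta x 0).

Lemma scaled_truncS x k :
  scaled_trunc x k.+1 = 10 * scaled_trunc x k + theta x k.+1.
Proof. by []. Qed.

Lemma trunc_scaled x k : trunc x k = (scaled_trunc x k)%:~R / 10 ^+ k.
Proof.
elim: k => [|k IHk]; first by rewrite /trunc big_geq // addr0 divr1.
have -> : trunc x k.+1 = trunc x k + (theta x k.+1)%:~R * 10 ^- k.+1.
  by rewrite /trunc big_nat_recr //= addrA.
have p_neq0 := exp10_neq0 rat k.
by rewrite IHk scaled_truncS intrD intrM exprS; field.
Qed.

Lemma theta_ge0 x k : 0 <= theta x k.+1.
Proof. by []. Qed.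

Lemma theta_le9 x k : theta x k.+1 <= 9.
Proof. by rewrite /= lez_nat -ltnS ltn_ord. Qed.

Lemma decimal_ext x y : (forall k, theta x k = theta y k) -> x = y.
Proof.
case: x y => [a d dP] [b e eP] xy; have /= ab := xy 0%N.
have de : d = e by apply/funext => k; apply/val_inj; have [] := xy k.+1.
by case: _ / ab xy; case: _ / de eP => eP _; rewrite (Prop_irrelevance dP eP).
Qed.

Lemma scaled_trunc_inj x y : scaled_trunc x =1 scaled_trunc y -> x = y.
Proof.
move=> xy; apply: decimal_ext => -[|k]; first exact: (xy 0%N).
by have := xy k.+1; rewrite !scaled_truncS xy => /addrI.
Qed.

(** The sequence iterates, from 0, a choice function [f] with [m < f m]; the strict inequality at 0
    makes its first term positive. *)
Lemma increasing_frequently (P : nat -> Prop) :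
    (forall m, exists2 k, (m < k)%N & P k) ->
  exists2 k, increasing_pos k & forall i, P (k i).
Proof.
move=> freq; have [f f_gt fP] : exists2 f : nat -> nat,
    forall m, (m < f m)%N & forall m, P (f m).
  have /choice[f fP] : forall m, exists k, (m < k)%N /\ P k.
    by move=> m; have [k] := freq m; exists k.
  by exists f => m; have [] := fP m.
exists (fun i => iter i.+1 f 0%N); last by move=> i; exact: fP.
by split=> [|i]; exact: f_gt.
Qed.

Lemma ltn_increasing_pos (k : nat -> nat) :
  increasing_pos k -> forall i, (i < k i)%N.
Proof. by move=> [k0 kS]; elim=> // i IHi; exact: leq_trans (kS i). Qed.

(** * The real value of a decimal *)

Section Value.
Variable R : realType.
Implicit Types (x y z : decimal) (r : R).

Let lower x k : R := (scaled_trunc x k)%:~R / 10 ^+ k.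
Let upper x k : R := (scaled_trunc x k + 1)%:~R / 10 ^+ k.

Definition value x : R := sup (range (lower x)).

Let lowerS x k : lower x k.+1 = lower x k + (theta x k.+1)%:~R / 10 ^+ k.+1.
Proof.
have p_neq0 := exp10_neq0 R k.
by rewrite /lower scaled_truncS intrD intrM exprS; field.
Qed.

Let upperS x k :
  upper x k.+1 = upper x k - (9 - (theta x k.+1)%:~R) / 10 ^+ k.+1.
Proof.
have p_neq0 := exp10_neq0 R k.
by rewrite /upper scaled_truncS !intrD intrM exprS; field.
Qed.

Let upper_le x j k : (j <= k)%N -> upper x k <= upper x j.
Proof.
move=> /subnK <-; elim: (k - j)%N => [//|i IHi]; rewrite addSn upperS.
apply: le_trans IHi; rewrite gerBl divr_ge0 ?(ltW (exp10_gt0 _ _)) // subr_ge0.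
by rewrite (ler_int _ _ 9) theta_le9.
Qed.

Let lower_le x j k : (j <= k)%N -> lower x j <= lower x k.
Proof.
move=> /subnK <-; elim: (k - j)%N => [//|i IHi]; rewrite addSn lowerS.
apply: le_trans IHi _; rewrite lerDl divr_ge0 ?ler0z //.
exact: ltW (exp10_gt0 _ _).
Qed.

Let lower_le_upper x j k : lower x j <= upper x k.
Proof.
have lu i : lower x i <= upper x i.
  by rewrite ler_pM2r ?invr_gt0 ?exp10_gt0 // ler_int lerDl.
apply: le_trans (lower_le x (leq_maxl j k)) (le_trans (lu _) _).
exact: upper_le (leq_maxr j k).
Qed.

Let lower_le_value x k : lower x k <= value x.
Proof.
apply: ub_le_sup; last by exists k.
by exists (upper x 0) => _ [j _ <-].
Qed.

(** A later digit below 9 makes [upper] drop strictly. This is where tails of nines are excluded;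
    strictness turns the truncation into a floor. *)
Let value_lt_upper x k : value x < upper x k.
Proof.
have [j le_kj dj] := frac_digit_lt9 x k.
apply: (@le_lt_trans _ _ (upper x j.+1)).
  by apply: ge_sup => [|_ [i _ <-] //]; exists (lower x 0), 0%N.
apply: lt_le_trans (upper_le x le_kj); rewrite upperS gtrBl.
by rewrite divr_gt0 ?exp10_gt0 // subr_gt0 (ltr_int _ _ 9).
Qed.

Lemma floor_value x k : Num.floor (10 ^+ k * value x) = scaled_trunc x k.
Proof.
apply: floor_def; rewrite mulrC -ler_pdivrMr ?exp10_gt0 //.
by rewrite -ltr_pdivlMr ?exp10_gt0 // lower_le_value value_lt_upper.
Qed.

Lemma floor_value0 x : Num.floor (value x) = theta x 0.
Proof. by have := floor_value x 0; rewrite mul1r. Qed.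

Lemma value_inj : injective value.
Proof.
by move=> x y xy; apply: scaled_trunc_inj => k; rewrite -!floor_value xy.
Qed.

Lemma ratr_trunc x k : ratr (trunc x k) = (scaled_trunc x k)%:~R / 10 ^+ k :> R.
Proof. by rewrite trunc_scaled fmorph_div rmorphXn rmorph_int rmorph_nat. Qed.

Lemma theta_value x k :
  theta x k.+1 =
  Num.floor (10 ^+ k.+1 * value x) - 10 * Num.floor (10 ^+ k * value x).
Proof. by rewrite !floor_value scaled_truncS addrC addKr. Qed.

(** * The decimal expansion of a real number *)

Definition real_digit r k : 'I_10 :=
  inord (absz (Num.floor (10 ^+ k.+1 * r) - 10 * Num.floor (10 ^+ k * r))%R).

(** Neither [absz] nor [inord] loses anything, since [floor_exp10S] puts the difference between 0
    and 9. *)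
Lemma real_digitE r k :
  (real_digit r k)%:Z =
  Num.floor (10 ^+ k.+1 * r) - 10 * Num.floor (10 ^+ k * r).
Proof.
rewrite /real_digit; have /andP[d_ge0 d_lt10] := floor_exp10S r k.
by rewrite inordK ?gez0_abs // -ltz_nat gez0_abs.
Qed.

(** If all digits were 9 from [m] on, [carry_nines] would make 10^m r equal to its own floor plus
    1. *)
Lemma real_digit_lt9 r m : exists2 k, (m <= k)%N & (real_digit r k < 9)%N.
Proof.
apply: contrapT => no_k.
have nines k : (m <= k)%N ->
    Num.floor (10 ^+ k.+1 * r) = 10 * Num.floor (10 ^+ k * r) + 9.
  move=> le_mk; have -> : 9 = (real_digit r k)%:Z.
    congr Posz; apply/eqP; rewrite eq_sym eqn_leq -ltnS ltn_ord leqNgt.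
    by apply/negP => lt9; apply: no_k; exists k.
  by rewrite real_digitE addrC subrK.
have : 10 ^+ m * r = (Num.floor (10 ^+ m * r) + 1)%:~R.
  apply: (@carry_nines _ (fun k => Num.floor (10 ^+ k * r)) r 1) => // k _.
  by have := floor_itv (10 ^+ k * r); rewrite intrD => /andP[-> /ltW ->].
by have /andP[_ /[swap] <-] := floor_itv (10 ^+ m * r); rewrite ltxx.
Qed.

Definition decimal_of r : decimal :=
  Decimal (Num.floor r) (real_digit_lt9 r).

Lemma decimal_ofK : cancel decimal_of value.
Proof.
move=> r; apply: floor_exp10_inj => m; exists m => //; rewrite floor_value.
elim: m => [|m IHm]; first by rewrite mul1r.
by rewrite scaled_truncS IHm [theta _ _]real_digitE addrC subrK.
Qed.

(** * Lexicographic order and order of values *)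

Lemma lt_decimal_value x y : lt_decimal x y -> value x < value y.
Proof.
move=> [k eqk ltk]; have lt_xy : (scaled_trunc x k < scaled_trunc y k)%R.
  case: k => [|k] in eqk ltk *; first exact: ltk.
  rewrite !scaled_truncS (_ : scaled_trunc x k = scaled_trunc y k) ?ltrD2l //.
  elim: k eqk {ltk} => [|k IHk] eqk; first exact: eqk.
  by rewrite !scaled_truncS eqk ?IHk // => i lt_ik; rewrite eqk // ltnW.
rewrite -(ltr_pM2l (exp10_gt0 R k)) -[ltRHS]/(10 ^+ k * value y).
rewrite -!floor_value floor_lt_int in lt_xy.
exact: lt_le_trans lt_xy (floor_le _).
Qed.

Lemma le_decimal_value x y : le_decimal x y <-> value x <= value y.
Proof.
split=> [[->//|/lt_decimal_value/ltW//]|le_xy].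
have [xy|/existsNP neq] := pselect (forall k, theta x k = theta y k).
  by left; apply: decimal_ext.
right; have ex_k : exists k, theta x k != theta y k.
  by case: neq => k /eqP ?; exists k.
(* The first differing digit decides: the opposite order there would give [lt_decimal y x], against
   [le_xy]. *)
case: (ex_minnP ex_k) => k neq_k min_k.
have eq_lt i : (i < k)%N -> theta x i = theta y i.
  by apply: contraTeq => /min_k; rewrite -leqNgt.
exists k => //; rewrite lt_neqAle neq_k leNgt; apply/negP => lt_yx.
suff /lt_decimal_value : lt_decimal y x by rewrite ltNge le_xy.
by exists k => // i /eq_lt.
Qed.

Lemma nonneg_value x : nonneg x = (0 <= value x).
Proof. by rewrite /nonneg -floor_value0 floor_ge0. Qed.

(** * Terminating decimals *)

Lemma terminates_value x m : terminates_at x m -> value x = ratr (trunc x m).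
Proof.
move=> x_m; have {x_m} lowerE k : (m <= k)%N -> lower x k = lower x m.
  move=> /subnK <-; elim: (k - m)%N => [//|i IHi].
  by rewrite addSn lowerS x_m ?ltnS ?leq_addl // mul0r addr0.
rewrite ratr_trunc; apply/eqP; rewrite -subr_eq0; apply/eqP.
apply: (@scaled_bounded_eq0 _ _ 1) => k; exists (m + k)%N.
  exact: leq_addl.
rewrite -[_ / _]/(lower x m) -(lowerE (m + k)%N) ?leq_addr // /lower.
have p_neq0 := exp10_neq0 R (m + k).
rewrite mulrBr [_ * (_ / _)]mulrC divfK // -floor_value.
have := floor_itv (10 ^+ (m + k) * value x); rewrite intrD ler_norml.
by move=> /andP[? ?]; apply/andP; split; lra.
Qed.

(* The hypothesis says that [q] is the value of a terminating decimal. *)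
Lemma value_of_rat (q : rat) (n : int) m :
  q * 10 ^+ m = n%:~R -> value (of_rat q) = ratr q.
Proof.
move=> qn; have : exists x, exists2 j, terminates_at x j & trunc x j = q.
  have rn : 10 ^+ m * ratr q = n%:~R :> R.
    by rewrite mulrC -ratr_int -qn rmorphM rmorphXn rmorph_nat.
  have rnk k : 10 ^+ (k + m) * ratr q = (10 ^+ k * n)%:~R :> R.
    by rewrite exprD -mulrA rn intrM rmorphXn.
  (* Beyond position [m] the scaled rational is an integer, so its floors are exact and the digits
     of its expansion vanish. *)
  exists (decimal_of (ratr q)), m.
    case=> // k; rewrite ltnS theta_value decimal_ofK => /subnK <-.
    by rewrite -addSn !rnk !intrKfloor exprS mulrA subrr.
  apply: (fmorph_inj (@ratr R)); rewrite /= ratr_trunc -floor_value.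
  rewrite decimal_ofK rn intrKfloor -rn.
  by rewrite mulrC mulKf // exp10_neq0.
by move=> /getPex[j /terminates_value -> ->].
Qed.

(** * Recognising a value from truncations *)

Lemma value_trunc_inj z r (k : nat -> nat) : increasing_pos k ->
    (forall i, Num.floor (10 ^+ (k i).-1 * value z)
               = Num.floor (10 ^+ (k i).-1 * r)) ->
  value z = r.
Proof.
move=> /ltn_increasing_pos k_gt zr; apply: floor_exp10_inj => m.
by exists (k m).-1 => //; rewrite -ltnS prednK // (leq_trans _ (k_gt m)).
Qed.

Lemma eq_trunc x y k :
  trunc x k = trunc y k <->
  Num.floor (10 ^+ k * value x) = Num.floor (10 ^+ k * value y).
Proof.
rewrite !trunc_scaled !floor_value; split=> [|-> //].
have p_neq0 := exp10_neq0 rat k.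
by move/(mulIf (invr_neq0 p_neq0))/intr_inj.
Qed.

Lemma trunc_mul_exp10 x k : trunc x k * 10 ^+ k = (scaled_trunc x k)%:~R.
Proof. by rewrite trunc_scaled divfK // exp10_neq0. Qed.

(* The common shape of [add_spec] and of [mul_nonneg_spec]. *)
Definition digit_spec (nine : nat -> Prop) (w u : nat -> decimal) z : Prop :=
  (exists2 m, (forall k, (m < k)%N -> nine k) & z = w m)
  \/ (~ (exists m, forall k, (m < k)%N -> nine k)) /\
     (exists k : nat -> nat,
        [/\ increasing_pos k, forall i, ~ nine (k i) &
            forall i, trunc z (k i).-1 = trunc (u (k i)) (k i).-1]).

(** Each choice of [m] or (k_i) forces the value [r], and conversely one of the two cases always
    offers a choice. The equivalence thus gives independence of choices, and existence through
    [decimal_of r], so the result of [get] is known. *)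
Lemma digit_specP (nine : nat -> Prop) (w u : nat -> decimal) r z :
    (forall m, (forall k, (m < k)%N -> nine k) -> value (w m) = r) ->
    (forall k, ~ nine k.+1 ->
       Num.floor (10 ^+ k * value (u k.+1)) = Num.floor (10 ^+ k * r)) ->
  digit_spec nine w u z <-> value z = r.
Proof.
move=> wr ur; have {}ur k : increasing_pos k -> (forall i, ~ nine (k i)) ->
    forall i, Num.floor (10 ^+ (k i).-1 * value (u (k i)))
              = Num.floor (10 ^+ (k i).-1 * r).
  move=> /ltn_increasing_pos k_gt nine_k i.
  by have := nine_k i; case: (k i) (k_gt i) => // j _; apply: ur.
split=> [[[m nine_m ->]|[_ [k [k_incr nine_k z_k]]]]|zr]; first exact: wr.
  apply: (value_trunc_inj k_incr) => i; have /eq_trunc -> := z_k i.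
  exact: ur.
have [[m nine_m]|no_m] := pselect (exists m, forall k, (m < k)%N -> nine k).
  by left; exists m => //; apply: value_inj; rewrite zr wr.
right; split=> //.
(* When [nine] does not hold from some point on, it fails at arbitrarily large positions. *)
have [|k k_incr nine_k] := @increasing_frequently (fun k => ~ nine k).
  move=> m; apply: contrapT => no_k; apply: no_m; exists m => k lt_mk.
  by apply: contrapT => nine_k; apply: no_k; exists k.
by exists k; split=> // i; apply/eq_trunc; rewrite zr ur.
Qed.

(** * Addition *)

Lemma scaled_trunc_bound x k :
  (scaled_trunc x k)%:~R <= 10 ^+ k * value x < (scaled_trunc x k)%:~R + 1.
Proof. by have := floor_itv (10 ^+ k * value x); rewrite floor_value intrD. Qed.

Lemma value_add_decimal x y : value (add_decimal x y) = value x + value y.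
Proof.
pose N k := scaled_trunc x k + scaled_trunc y k.
have sumE k : ratr (trunc x k + trunc y k) = (N k)%:~R / 10 ^+ k :> R.
  by rewrite rmorphD /= !ratr_trunc -mulrDl -intrD.
have value_sum k : value (of_rat (trunc x k + trunc y k)) = (N k)%:~R / 10 ^+ k.
  rewrite (@value_of_rat _ (N k) k) // mulrDl !trunc_mul_exp10.
  by rewrite -intrD.
(* Each of the two truncations loses less than one unit, whence the 2. *)
have N_bound k : (N k)%:~R <= 10 ^+ k * (value x + value y) < (N k)%:~R + 2.
  have := scaled_trunc_bound x k; have := scaled_trunc_bound y k.
  by rewrite intrD mulrDr => /andP[? ?] /andP[? ?]; apply/andP; split; lra.
have NS k : N k.+1 = 10 * N k + (theta x k.+1 + theta y k.+1).
  by rewrite /N !scaled_truncS; ring.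
suff addP z : add_spec x y z <-> value z = value x + value y.
  apply/addP/(@getPex _ (add_spec x y)).
  by exists (decimal_of (value x + value y)); apply/addP/decimal_ofK.
apply: (@digit_specP (fun k => theta x k + theta y k = 9)
  (fun m => of_rat (trunc x m + trunc y m + 10 ^- m))
  (fun k => of_rat (trunc x k + trunc y k))) => [m nines|k].
  rewrite (@value_of_rat _ (N m + 1) m); last first.
    rewrite 2!mulrDl !trunc_mul_exp10 !intrD.
    by rewrite mulVf ?exp10_neq0 //.
  rewrite rmorphD /= sumE fmorphV rmorphXn rmorph_nat.
  rewrite -[X in _ + X]mul1r -mulrDl.
  rewrite -(intrD _ _ 1) -(@carry_nines _ N (value x + value y) 2).
  - by rewrite mulrC mulKf // exp10_neq0.
  - by move=> k le_mk; rewrite NS nines.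
  by move=> k _; have /andP[-> /ltW ->] := N_bound k.
set d := theta x k.+1 + theta y k.+1 => d_neq9.
rewrite value_sum.
have -> : 10 ^+ k * ((N k.+1)%:~R / 10 ^+ k.+1) = (N k.+1)%:~R / 10 :> R.
  by have p_neq0 := exp10_neq0 R k; rewrite exprS; field.
have [d_ge0 d_le18] : 0 <= d /\ d <= 18.
  split; first exact: addr_ge0 (theta_ge0 x k) (theta_ge0 y k).
  exact: lerD (theta_le9 x k) (theta_le9 y k).
have := N_bound k.+1; rewrite exprS -mulrA NS -/d.
clearbody N d; rewrite !intrD intrM.
set v := 10 ^+ k * _; set Nk := (N k)%:~R => /andP[v_ge v_lt].
(* Here [c] is the carry into position [k]: 0 for d <= 8 and 1 for d >= 10. The error of 2 units
   cannot reach the next multiple of ten, whereas from d = 9 it could. *)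
have carry (c : int) : (10 * c)%:~R <= d%:~R :> R ->
    d%:~R + 2 <= (10 * c + 10)%:~R :> R ->
    Num.floor ((10 * Nk + d%:~R) / 10) = N k + c /\ Num.floor v = N k + c.
  rewrite intrD !intrM => c_le c_ge.
  by split; apply: floor_def; rewrite !intrD -/Nk; apply/andP; split; lra.
have [d_le8|d_ge10] : d <= 8 \/ 10 <= d by lia.
  have [||-> ->//] := carry 0; rewrite ?ler_int //.
  by rewrite -[2]/(2%:~R) -intrD ler_int; lia.
have [||-> ->//] := carry 1; rewrite ?ler_int //.
by rewrite -[2]/(2%:~R) -intrD ler_int; lia.
Qed.

(** * Additive inverse *)

Definition nines_complement x (x_inf : ~ exists m, terminates_at x m) : decimal.
Proof.
(* On ['I_10], [rev_ord] sends d to 9 - d, so a tail of nines here would be a tail of zeros in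
   [x]. *)
apply: (@Decimal (- 1 - int_part x) (fun k => rev_ord (frac_digit x k))) => m.
apply: contrapT => no_k; apply: x_inf; exists m => -[//|k].
rewrite ltnS => le_mk.
apply: contrapT => xk_neq0; apply: no_k; exists k => //=.
have : (frac_digit x k : nat) != 0%N.
  by apply/eqP => xk0; rewrite /= xk0 in xk_neq0.
lia.
Defined.

Lemma value_nines_complement x z : theta z 0 = - 1 - theta x 0 ->
  (forall k, (0 < k)%N -> theta z k = 9 - theta x k) -> value z = - value x.
Proof.
(* At every scale the two integers add up to -1, which leaves the scaled sum of the values between
   -1 and 1. *)
move=> z0 zS; have zE k : scaled_trunc z k = - 1 - scaled_trunc x k.
  elim: k => [|k IHk]; first exact: z0.
  by rewrite !scaled_truncS IHk zS //; ring.
apply/eqP; rewrite -addr_eq0; apply/eqP.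
apply: (@scaled_bounded_eq0 _ _ 1) => k; exists k => //.
have := scaled_trunc_bound z k; have := scaled_trunc_bound x k.
rewrite zE mulrDr intrD !rmorphN ler_norml.
by move=> /andP[? ?] /andP[? ?]; apply/andP; split; lra.
Qed.

Lemma value_opp_decimal x : value (opp_decimal x) = - value x.
Proof.
suff : opp_spec x (opp_decimal x).
  case=> [[m x_m ->]|[_]]; last exact: value_nines_complement.
  rewrite (@value_of_rat _ (- scaled_trunc x m) m).
    by rewrite rmorphN /= -terminates_value.
  by rewrite mulNr trunc_mul_exp10 rmorphN.
apply: getPex; have [[m x_m]|x_inf] := pselect (exists m, terminates_at x m).
  by exists (of_rat (- trunc x m)); left; exists m.
exists (nines_complement x_inf); right; split=> // -[//|k] _ /=.
by have := ltn_ord (frac_digit x k); lia.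
Qed.

(** * Multiplication *)

Lemma mul_increment (a a' b b' e S : R) :
    0 <= a -> 0 <= b -> a <= a' <= a + e -> b <= b' <= b + e -> a' + b' <= S ->
  a * b <= a' * b' <= a * b + e * S.
Proof.
(* The upper bound comes from a'b' - ab = (a' - a) b' + a (b' - b) <= e (b' + a) <= e (a' + b'). *)
move=> a_ge0 b_ge0 /andP[aa' a'e] /andP[bb' b'e] leS.
have e_ge0 : 0 <= e by lra.
have := ler_wpM2l e_ge0 leS; rewrite mulrDr => ?.
have := ler_wpM2r (le_trans b_ge0 bb') a'e; rewrite mulrDl => ?.
have := ler_wpM2l a_ge0 b'e; rewrite mulrDr => ?.
have := ler_wpM2r e_ge0 aa'; rewrite [a' * e]mulrC => ?.
have := ler_wpM2r (le_trans b_ge0 bb') aa'; have := ler_wpM2l a_ge0 bb' => ? ?.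
by apply/andP; split; lra.
Qed.

Lemma mul_nonneg_spec_value s x y z : 0 <= value x -> 0 <= value y ->
    value x + value y <= 10 ^+ s ->
  digit_spec (fun k => theta (trunc_prod s x y k) k = 9)
    (fun m => of_rat (trunc (trunc_prod s x y m) m + 10 ^- m))
    (trunc_prod s x y) z <-> value z = value x * value y.
Proof.
move=> x_ge0 y_ge0 le_s; set r := value x * value y.
pose q k := value (trunc_prod s x y k).
have qE k : q k = lower x (k + s) * lower y (k + s).
  rewrite /q /trunc_prod (@value_of_rat _
    (scaled_trunc x (k + s) * scaled_trunc y (k + s)) ((k + s) + (k + s))).
    by rewrite rmorphM /= !ratr_trunc.
  by rewrite exprD mulrACA !trunc_mul_exp10 intrM.
have lower_ge0 t n : 0 <= value t -> 0 <= lower t n.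
  rewrite -floor_ge0 floor_value0 -(ler0z R) => /le_trans; apply.
  by rewrite -[leLHS]divr1; exact: (@lower_le t 0 n).
have lower_step t n : lower t n <= lower t n.+1 <= lower t n + 9 / 10 ^+ n.+1.
  rewrite lower_le //= lowerS lerD2l ler_pM2r ?invr_gt0 ?exp10_gt0 //.
  by rewrite (ler_int _ _ 9) theta_le9.
have lower_value t n : lower t n <= value t <= lower t n + 1 / 10 ^+ n.
  by rewrite lower_le_value /= -mulrDl -(intrD _ _ 1) ltW ?value_lt_upper.
(* The [s] extra digits of the operands offset the factor 10^s by which [mul_increment] magnifies
   their error. *)
have scale_s (c : R) k : c / 10 ^+ (k + s) * 10 ^+ s = c / 10 ^+ k.
  by rewrite exprD; field; rewrite !exp10_neq0.
have q_step k : q k <= q k.+1 <= q k + 9 / 10 ^+ k.+1.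
  rewrite !qE addSn -(scale_s _ k.+1) addSn.
  apply: mul_increment; rewrite ?lower_ge0 //.
  by apply: le_trans le_s; apply: lerD.
have q_r k : q k <= r <= q k + 1 / 10 ^+ k.
  by rewrite qE -(scale_s _ k); apply: mul_increment; rewrite ?lower_ge0.
pose Fl j (v : R) := Num.floor (10 ^+ j * v).
have scaled_step (c : R) k v : 10 ^+ k * (v + c / 10 ^+ k) = 10 ^+ k * v + c.
  by field; rewrite exp10_neq0.
have Fl_r k : 10 ^+ k * q k <= 10 ^+ k * r <= 10 ^+ k * q k + 1.
  by have := q_r k; rewrite -scaled_step !ler_pM2l ?exp10_gt0.
apply: digit_specP => [m nines|k].
  have nine_step k : (m <= k)%N -> Fl k.+1 (q k.+1) = 10 * Fl k (q k) + 9.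
    move=> le_mk; have := nines k.+1 le_mk.
    rewrite theta_value -/(q _) -!/(Fl _ _).
    move=> d9; suff <- : Fl k (q k.+1) = Fl k (q k) by rewrite -d9 addrC subrK.
    (* If the floor at scale [k] grew from [q k] to [q k.+1], the digit 9 after it would put
       10^(k+1) q_(k+1) more than 9 above 10^(k+1) q_k, against [q_step]. *)
    have /andP[q_le q_ge] := q_step k; apply/eqP; rewrite eq_le -ltzD1 andbC.
    rewrite le_floor ?ler_pM2l ?exp10_gt0 //= -(ltr_int R).
    rewrite -(ler_pM2l (exp10_gt0 R k.+1)) scaled_step exprS -!mulrA in q_ge.
    have := floor_itv (10 ^+ k * q k); have := floor_itv (10 ^+ k.+1 * q k.+1).
    rewrite -!/(Fl _ _) -[Fl k.+1 _](subrK (10 * Fl k (q k.+1))) d9.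
    rewrite exprS -mulrA !intrD !intrM.
    by move=> /andP[? ?] /andP[? ?]; lra.
  have rE : 10 ^+ m * r = (Fl m (q m) + 1)%:~R.
    (* The 2 adds the loss from the floor to the gap between [q k] and [r], each at most one
       unit. *)
    apply: (@carry_nines _ (fun k => Fl k (q k)) r 2 m nine_step) => k _.
    have := Fl_r k; have := floor_itv (10 ^+ k * q k); rewrite -/(Fl _ _) intrD.
    by move=> /andP[? ?] /andP[? ?]; apply/andP; split; lra.
  rewrite (@value_of_rat _ (Fl m (q m) + 1) m); last first.
    rewrite mulrDl trunc_mul_exp10 mulVf ?exp10_neq0 //.
    by rewrite intrD /Fl floor_value.
  rewrite rmorphD /= ratr_trunc -floor_value fmorphV rmorphXn rmorph_nat.
  rewrite -[X in _ + X]mul1r -mulrDl -(intrD _ _ 1) -/(q m) -/(Fl _ _) -rE.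
  by rewrite mulrC mulKf // exp10_neq0.
rewrite theta_value -/(q _) -!/(Fl _ _) => not9; apply/esym/floor_def.
have /andP[d_ge0 d_lt10] := floor_exp10S (q k.+1) k.
rewrite -!/(Fl _ _) in d_ge0 d_lt10.
(* With a digit at most 8, adding the gap of at most one unit up to [r] stays below the next
   multiple of ten. *)
have {d_ge0 d_lt10} : Fl k.+1 (q k.+1) <= 10 * Fl k (q k.+1) + 8.
  move: (Fl _ _) (Fl _ _) not9 d_ge0 d_lt10 => b c; lia.
rewrite -(ler_int R) !intrD !intrM.
have := floor_itv (10 ^+ k * q k.+1); have := floor_itv (10 ^+ k.+1 * q k.+1).
have := Fl_r k.+1; rewrite -!/(Fl _ _) exprS -!mulrA !intrD.
move=> /andP[? ?] /andP[? ?] /andP[? ?] ?; apply/andP; split; lra.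
Qed.

Lemma value_mul_nonneg x y : 0 <= value x -> 0 <= value y ->
  value (mul_nonneg x y) = value x * value y.
Proof.
move=> x_ge0 y_ge0.
have le_exp10 s : le_decimal (add_decimal x y) (of_rat (10 ^+ s)) <->
    value x + value y <= 10 ^+ s.
  rewrite le_decimal_value value_add_decimal (@value_of_rat _ (10 ^+ s) 0).
    by rewrite rmorphXn rmorph_nat.
  by rewrite mulr1 rmorphXn.
suff mulP z : mul_nonneg_spec x y z <-> value z = value x * value y.
  apply/mulP/(@getPex _ (mul_nonneg_spec x y)).
  by exists (decimal_of (value x * value y)); apply/mulP/decimal_ofK.
split=> [[s /le_exp10 le_s]|zr]; first by move/mul_nonneg_spec_value; apply.
have [s /ltW le_s] := ltr_exp10 (value x + value y).
by exists s; [apply/le_exp10 | apply/mul_nonneg_spec_value].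
Qed.

Lemma value_mul_decimal x y : value (mul_decimal x y) = value x * value y.
Proof.
rewrite /mul_decimal !nonneg_value.
have neg_ge0 t : (0 <= value t) = false -> 0 <= value (opp_decimal t).
  by move=> /negbT; rewrite value_opp_decimal oppr_ge0 -ltNge => /ltW.
case x0: (0 <= _); case y0: (0 <= _);
  rewrite ?value_opp_decimal value_mul_nonneg ?neg_ge0 // !value_opp_decimal.
- by rewrite mulrN opprK.
- by rewrite mulNr opprK.
- by rewrite mulrNN.
Qed.

End Value.

(** * Transfer of the field axioms from a concrete real field *)

Local Notation valueR := (@value Rdefinitions.R).
Local Notation decimalR := (@decimal_of Rdefinitions.R).
Local Notation value_injR := (@value_inj Rdefinitions.R).

Local Notation value_addR := (value_add_decimal Rdefinitions.R).
Local Notation value_mulR := (value_mul_decimal Rdefinitions.R).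

(* Otherwise unification unfolds these constants and does not terminate. *)
Local Opaque value add_decimal opp_decimal mul_decimal.

Fact add_decimalA : associative add_decimal.
Proof. by move=> x y z; apply: value_injR; rewrite !value_addR addrA. Qed.

Fact add_decimalC : commutative add_decimal.
Proof. by move=> x y; apply: value_injR; rewrite !value_addR addrC. Qed.

Fact add_0decimal : left_id (decimalR 0) add_decimal.
Proof.
by move=> x; apply: value_injR; rewrite value_addR decimal_ofK add0r.
Qed.

Fact add_Ndecimal : left_inverse (decimalR 0) opp_decimal add_decimal.
Proof.
move=> x; apply: value_injR.
by rewrite value_addR value_opp_decimal decimal_ofK addNr.
Qed.

HB.instance Definition _ := GRing.isZmodule.Build decimal
  add_decimalA add_decimalC add_0decimal add_Ndecimal.

Fact mul_decimalA : associative mul_decimal.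
Proof. by move=> x y z; apply: value_injR; rewrite !value_mulR mulrA. Qed.

Fact mul_decimalC : commutative mul_decimal.
Proof. by move=> x y; apply: value_injR; rewrite !value_mulR mulrC. Qed.

Fact mul_1decimal : left_id (decimalR 1) mul_decimal.
Proof.
by move=> x; apply: value_injR; rewrite value_mulR decimal_ofK mul1r.
Qed.

Fact mul_decimalDl : left_distributive mul_decimal add_decimal.
Proof.
move=> x y z; apply: value_injR.
by rewrite value_mulR !value_addR !value_mulR mulrDl.
Qed.

Fact decimal1_neq0 : decimalR 1 != decimalR 0.
Proof. by rewrite (can_eq (@decimal_ofK _)) oner_eq0. Qed.

HB.instance Definition _ := GRing.Zmodule_isComNzRing.Build decimal
  mul_decimalA mul_decimalC mul_1decimal mul_decimalDl decimal1_neq0.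

(** With no digit-wise rule prescribed for inverses, the real inverse is pulled back, along with its
    convention at 0. *)
Definition inv_decimal (x : decimal) : decimal := decimalR (valueR x)^-1.

Fact mul_Vdecimal (x : decimal) : x != 0 -> inv_decimal x * x = 1.
Proof.
move=> x_neq0; apply: value_injR; rewrite value_mulR !decimal_ofK mulVf //.
apply: contra_neq x_neq0 => x0.
by apply: value_injR; rewrite x0 decimal_ofK.
Qed.

Fact inv_decimal0 : inv_decimal 0 = 0.
Proof. by rewrite /inv_decimal decimal_ofK invr0. Qed.

HB.instance Definition _ := GRing.ComNzRing_isField.Build decimal
  mul_Vdecimal inv_decimal0.

Theorem mainTheorem1 : is_field add_decimal mul_decimal.
Proof. by exists (GRing.Field.class decimal). Qed.
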